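(* Let $E$ and $F$ be sets in $\mathbb{F}_q^3$. Assume that the number of orthogonal pairs in $E\times F$ is at most $|E||F|/2$, and that any two planes of the form $v\cdot x=\lambda$ and $w\cdot x=\lambda$, with $v,w\in E$ and $\lambda\ne 0$, have at most $k$ collinear points in common from $F$. Assume in addition that $|F|>2kq^{\alpha}$ and that $E$ is not contained fully in any plane. Then $$|D(E,F)|\gg \begin{cases}\max\{k,\,q^{\alpha}\} & \text{if } |E|\ge q^{3\alpha},\\[2pt] \max\left\{k,\,\dfrac{|E|}{q^{2\alpha}}\right\} & \text{if } |E|\le q^{3\alpha}.\end{cases}$$
   Context: $\mathbb{F}_q$ is the finite field of order $q$, where $q$ is a prime power; $k$ is a positive integer and $\alpha$ is a real number. For $x,y\in\mathbb{F}_q^3$, $x\cdot y=x_1y_1+x_2y_2+x_3y_3$, and a pair $(x,y)\in E\times F$ is orthogonal if $x\cdot y=0$. The dot-product set between $E$ and $F$ is $D(E,F)=\{x\cdot y : x\in E,\ y\in F\}\subset\mathbb{F}_q$. The notation $f\gg g$ means $g=O(f)$.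
   Formalization: k is taken to be the least positive integer for which the ''at most k collinear points'' condition holds; for an arbitrary upper bound k the claim |D(E,F)| ≫ k fails (α = 0, E = F = F_q^3, k = ⌊q^3/3⌋, where |D(E,F)| = q). *)

(* Defs.v *)
From mathcomp Require Import all_boot all_order all_algebra.

Set Implicit Arguments.
Unset Strict Implicit.
Unset Printing Implicit Defensive.

Import GRing.Theory.

Local Open Scope ring_scope.

Definition dot (K : finFieldType) (x y : 'rV[K]_3) : K :=
  \sum_(i < 3) x ord0 i * y ord0 i.

Definition dot_product_set (K : finFieldType) (E F : {set 'rV[K]_3}) : {set K} :=
  [set dot x y | x in E, y in F].

Definition orthogonal_pairs (K : finFieldType) (E F : {set 'rV[K]_3}) :
    {set 'rV[K]_3 * 'rV[K]_3} :=
  [set p in setX E F | dot p.1 p.2 == 0].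

(* An affine plane when v != 0; for v = 0 and c != 0 it is empty. *)
Definition plane (K : finFieldType) (v : 'rV[K]_3) (c : K) : {set 'rV[K]_3} :=
  [set x | dot v x == c].

Definition contained_in_plane (K : finFieldType) (E : {set 'rV[K]_3}) : Prop :=
  exists v : 'rV[K]_3, exists c : K, v != 0 /\ E \subset plane v c.

Definition collinear (K : finFieldType) (S : {set 'rV[K]_3}) : Prop :=
  exists a b : 'rV[K]_3,
    b != 0 /\ forall x, x \in S -> exists t : K, x = a + t *: b.

(* "Two planes" are distinct planes: for c != 0, distinct v and w give distinct
   planes v.x = c and w.x = c. *)
Definition common_collinear_le (K : finFieldType) (E F : {set 'rV[K]_3})
    (k : nat) : Prop :=
  forall (v w : 'rV[K]_3) (c : K) (S : {set 'rV[K]_3}),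
    v \in E -> w \in E -> v != w -> c != 0 ->
    S \subset F :&: (plane v c :&: plane w c) -> collinear S ->
    (#|S| <= k)%N.

(* k is the least positive integer bounding the number of common collinear
   points. Minimality is what gives |D(E,F)| >> k its meaning: every k >= q is
   an upper bound, so for an arbitrary bound k that conclusion fails (take
   alpha = 0, E = F = F_q^3, k = floor(q^3 / 3), where |D(E,F)| = q). *)
Definition common_collinear_bound (K : finFieldType) (E F : {set 'rV[K]_3})
    (k : nat) : Prop :=
  [/\ (0 < k)%N, common_collinear_le E F k &
      forall j : nat, (0 < j)%N -> common_collinear_le E F j -> (k <= j)%N].

(* Main.v *)
(** The dot products of a vector with at most three elements spanning the span
    of F determine all its dot products with F, so at most |D|^3 vectors of E are
    determined in E by their dot products with F.  If these make up a quarter of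
    E, then |E| <= 4 |D|^3.  Otherwise at least a quarter of all pairs are
    non-orthogonal pairs (v, f) where v shares its dot products with some other
    w in E; for such v and c <> 0 the points of F on v.x = c lie on w.x = c too,
    hence on a line, so v has at most k |D| non-orthogonal f, and |F| <= 4 k |D|.

    For |D| >= k, minimality of k gives k collinear points of F, and since E is
    not contained in a plane, some u in E is not orthogonal to the direction of
    their line, so u has distinct dot products with them. *)
Require Import Defs.
From mathcomp Require Import all_boot all_order all_algebra.
From mathcomp Require Import reals exp.
From mathcomp Require Import zify lra.

Set Implicit Arguments.
Unset Strict Implicit.
Unset Printing Implicit Defensive.

Import Order.TTheory GRing.Theory Num.Theory.

Local Open Scope ring_scope.

Lemma dotE (K : finFieldType) (x y : 'rV[K]_3) : x *m y^T = (dot x y)%:M.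
Proof.
rewrite [LHS]mx11_scalar mxE; congr _%:M.
by apply: eq_bigr => i _; rewrite mxE.
Qed.

Lemma dotC (K : finFieldType) (x y : 'rV[K]_3) : dot x y = dot y x.
Proof. by apply: eq_bigr => i _; rewrite mulrC. Qed.

Lemma dotDr (K : finFieldType) (x y z : 'rV[K]_3) :
  dot x (y + z) = dot x y + dot x z.
Proof. by rewrite -big_split; apply: eq_bigr => i _; rewrite mxE mulrDr. Qed.

Lemma dotZr (K : finFieldType) (a : K) (x y : 'rV[K]_3) :
  dot x (a *: y) = a * dot x y.
Proof. by rewrite /dot mulr_sumr; apply: eq_bigr => i _; rewrite mxE mulrCA. Qed.

Lemma dotBr (K : finFieldType) (x y z : 'rV[K]_3) :
  dot x (y - z) = dot x y - dot x z.
Proof. by rewrite -scaleN1r dotDr dotZr mulN1r. Qed.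

Lemma dot0r (K : finFieldType) (x : 'rV[K]_3) : dot x 0 = 0.
Proof. by rewrite -(subrr x) dotBr subrr. Qed.

(** If S is nonempty, then v and w are linearly independent, so differences of points of S lie in
    the orthogonal complement of their span, which has dimension 3 - 2 = 1. *)
Lemma planes_collinear (K : finFieldType) (v w : 'rV[K]_3) (c : K)
    (S : {set 'rV[K]_3}) :
  v != w -> c != 0 -> S \subset plane v c :&: plane w c -> collinear S.
Proof.
move=> vw c0 /subsetP Svw.
have eqS x : x \in S -> dot v x = c /\ dot w x = c.
  by move=> /Svw; rewrite !inE => /andP[/eqP-> /eqP->].
have [->|[a aS]] := set_0Vmem S.
  exists 0, (const_mx 1); split; last by move=> x; rewrite inE.
  by apply/eqP => /matrixP/(_ 0 0); rewrite !mxE => /eqP; rewrite oner_eq0.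
have [va wa] := eqS a aS.
pose M : 'M[K]_(1 + 1, 3) := col_mx v (v - w).
have rkM : \rank M = 2.
  apply/eqP; apply: inj_row_free => u.
  rewrite -(hsubmxK u) mul_row_col [lsubmx u]mx11_scalar [rsubmx u]mx11_scalar.
  set s := lsubmx u 0 0; set t := rsubmx u 0 0; rewrite !mul_scalar_mx => uM0.
  (* Pairing s v + t (v - w) = 0 with the point a of S kills the second term and leaves s c = 0;
     this is where c <> 0 enters. *)
  have s0 : s = 0.
    have := dot0r a; rewrite -uM0 dotDr !dotZr dotBr ![dot a _]dotC va wa.
    by rewrite subrr mulr0 addr0 => /eqP; rewrite mulf_eq0 (negPf c0) orbF => /eqP.
  move/eqP: uM0; rewrite s0 scale0r add0r scaler_eq0 subr_eq0 (negPf vw) orbF.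
  by move=> /eqP->; rewrite !raddf0 row_mx0.
have rkK : \rank (kermx M^T) = 1 by rewrite mxrank_ker mxrank_tr rkM.
have [b bK b0] : exists2 b : 'rV_3, (b <= kermx M^T)%MS & b != 0.
  by apply/rowV0Pn; rewrite -mxrank_eq0 rkK.
exists a, b; split=> // x xS; have [vx wx] := eqS x xS.
have /sub_rVP[t xa] : (x - a <= b)%MS.
  apply: (submx_trans (_ : (_ <= kermx M^T)%MS)).
    apply/sub_kermxP; rewrite tr_col_mx mul_mx_row !dotE.
    rewrite ![dot (x - a) _]dotC !dotBr [dot (v - w) x]dotC [dot (v - w) a]dotC !dotBr.
    by rewrite ![dot _ v]dotC ![dot _ w]dotC vx wx va wa !subrr raddf0 row_mx0.
  (* The kernel has rank one, so its nonzero vector b spans it. *)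
  by have := mxrank_leqif_sup bK; rewrite rkK rank_rV b0 => -[_ <-].
by exists t; rewrite -xa addrC subrK.
Qed.

Lemma collinear_le_card_dot (K : finFieldType) (E F S : {set 'rV[K]_3}) :
  ~ contained_in_plane E -> S \subset F -> collinear S ->
  (#|S| <= #|dot_product_set E F|)%N.
Proof.
move=> nE /subsetP SF [a [b [b0 Sab]]].
have [u uE ub] : exists2 u, u \in E & dot u b != 0.
  apply/exists_inP; apply: contraT; rewrite negb_exists_in => /forall_inP h.
  (* Otherwise E would lie in the plane through 0 with normal b. *)
  case: nE; exists b, 0; split=> //; apply/subsetP => u /h; rewrite negbK inE.
  by rewrite dotC.
rewrite -(card_in_imset (_ : {in S &, injective (dot u)})).
  apply/subset_leq_card/subsetP => _ /imsetP[x xS ->].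
  by apply: imset2_f => //; apply: SF.
move=> x y xS yS; have [[s ->] [t ->]] := (Sab x xS, Sab y yS).
by rewrite !dotDr !dotZr => /addrI /(mulIf ub)->.
Qed.

(** By [collinear_le_card_dot], |D| is itself an admissible bound, and k is the least one. *)
Lemma bound_le_card_dot (K : finFieldType) (E F : {set 'rV[K]_3}) k :
  common_collinear_bound E F k -> ~ contained_in_plane E ->
  (0 < #|dot_product_set E F|)%N -> (k <= #|dot_product_set E F|)%N.
Proof.
move=> [k0 _ kmin] nE D0; apply: kmin => // v w c S _ _ _ _.
by rewrite subsetI => /andP[SF _]; apply: collinear_le_card_dot.
Qed.

Definition separated (K : finFieldType) (E F : {set 'rV[K]_3}) :=
  [set v in E | [forall w in E, [forall f in F, dot v f == dot w f] ==> (v == w)]].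

Lemma card_separated (K : finFieldType) (E F : {set 'rV[K]_3}) :
  (0 < #|dot_product_set E F|)%N ->
  (#|separated E F| <= #|dot_product_set E F| ^ 3)%N.
Proof.
move=> D0; set D := dot_product_set E F.
pose A : 'M[K]_(#|F|, 3) := \matrix_i enum_val i.
(* [g] selects [\rank A] rows of A, that is, elements of F, forming a basis of the span of F; [phi]
   records the dot products with them. *)
pose g := maxrankfun A.
pose phi (v : 'rV[K]_3) : {ffun 'I_(\rank A) -> K} :=
  [ffun i => dot v (enum_val (g i))].
have phi_inj : {in separated E F &, injective phi}.
  move=> v w; rewrite !inE => /andP[vE /forall_inP vs] /andP[wE _] /ffunP vw.
  apply/eqP; apply: (implyP (vs w wE)); apply/forall_inP => f fF.
  have fA : (f <= rowsub g A)%MS.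
    rewrite eq_maxrowsub -[f](enum_rankK_in fF fF).
    by have := row_sub (enum_rank_in fF f) A; rewrite rowK.
  case/submxP: fA => u fu; rewrite -subr_eq0 dotC [dot w f]dotC -dotBr.
  (* f is a combination of the selected rows, and v - w is orthogonal to each of these. *)
  have: f *m (v - w)^T = 0.
    rewrite fu -mulmxA; set z := (X in u *m X); suff -> : z = 0 by rewrite mulmx0.
    apply/row_matrixP => i; rewrite row0 row_mul row_rowsub rowK dotE.
    rewrite dotBr; have := vw i; rewrite !ffunE ![dot _ (enum_val _)]dotC => ->.
    by rewrite subrr raddf0.
  by rewrite dotE => /matrixP/(_ 0 0); rewrite !mxE eqxx mulr1n => ->.
rewrite -(card_in_imset phi_inj).
(* The rank may be below 3; raising the exponent to 3 uses |D| > 0. *)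
apply: (@leq_trans (#|D| ^ \rank A)); last by rewrite leq_pexp2l // rank_leq_col.
rewrite -[X in (_ <= _ ^ X)%N]card_ord -card_ffun_on; apply/subset_leq_card/subsetP.
move=> _ /imsetP[v vs ->]; apply/ffun_onP => i; rewrite ffunE.
by apply: imset2_f; [case/setIdP: vs | apply: enum_valP].
Qed.

Lemma card_nonorth (K : finFieldType) (E F : {set 'rV[K]_3}) k v :
  common_collinear_le E F k -> v \in E -> v \notin separated E F ->
  (#|[set f in F | dot v f != 0%R]| <= #|dot_product_set E F| * k)%N.
Proof.
move=> hk vE; rewrite inE vE /= negb_forall_in => /exists_inP[w wE].
rewrite negb_imply => /andP[/forall_inP vwF vw].
rewrite -sum1_card (partition_big (dot v) [in dot_product_set E F]) /=; last first.
  by move=> f; rewrite inE => /andP[fF _]; apply: imset2_f.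
rewrite -sum_nat_const; apply: leq_sum => c _.
(* The fibre over c = 0 is empty, since only non-orthogonal f are counted; every other fibre lies in
   both planes of level c. *)
have [->|c0] := eqVneq c 0.
  by rewrite big1 // => f; rewrite inE => /andP[/andP[_ /negPf->]].
pose S := F :&: (plane v c :&: plane w c).
apply: (@leq_trans #|S|).
  rewrite sum1_card; apply/subset_leq_card/subsetP => f.
  rewrite unfold_in !inE => /andP[/andP[fF _] /eqP vf].
  by rewrite fF -(eqP (vwF f fF)) vf eqxx.
apply: (hk v w c) => //; apply: planes_collinear vw c0 _.
exact: subsetIr.
Qed.

(** The non-orthogonal pairs are split by their first entry: a separated v gets the trivial bound
    |F|, any other v the bound of [card_nonorth]. *)
Lemma card_pairs_le (K : finFieldType) (E F : {set 'rV[K]_3}) k :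
  common_collinear_le E F k ->
  (#|E| * #|F| <= #|orthogonal_pairs E F| + #|separated E F| * #|F|
     + #|E| * (#|dot_product_set E F| * k))%N.
Proof.
move=> hk; set D := dot_product_set E F; set E1 := separated E F.
have E1E : E1 \subset E by apply/subsetP => v /setIdP[].
rewrite -cardsX -addnA -(cardsID (orthogonal_pairs E F) (setX E F)).
apply: leq_add; first by apply/subset_leq_card/subsetIr.
have -> : #|setX E F :\: orthogonal_pairs E F| =
    (\sum_(v in E) #|[set f in F | dot v f != 0%R]|)%N.
  rewrite -sum1_card (eq_bigl (fun p => (p.1 \in E) &&
      (p.2 \in [set f in F | dot p.1 f != 0%R]))).
    rewrite -(pair_big_dep (mem E)
      (fun v f => f \in [set f in F | dot v f != 0%R]) (fun _ _ => 1%N)) /=.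
    by apply: eq_bigr => v _; rewrite sum1_card.
  by case=> v f; rewrite !inE /=; do 2!case: (_ \in _); rewrite ?andbF ?andbT.
rewrite (big_setID E1) /= (setIidPr E1E); apply: leq_add.
  rewrite -sum_nat_const; apply: leq_sum => v _.
  by apply/subset_leq_card/subsetP => f /setIdP[].
apply: (@leq_trans (\sum_(v in E :\: E1) #|D| * k)%N).
  by apply: leq_sum => v /setDP[vE vE1]; apply: card_nonorth.
by rewrite sum_nat_const leq_mul2r subset_leq_card ?orbT // subsetDl.
Qed.

Lemma dichotomy (K : finFieldType) (E F : {set 'rV[K]_3}) k :
  (2 * #|orthogonal_pairs E F| <= #|E| * #|F|)%N -> common_collinear_le E F k ->
  (0 < #|E|)%N -> (0 < #|F|)%N ->
  (#|E| <= 4 * #|dot_product_set E F| ^ 3)%N \/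
  (#|F| <= 4 * (#|dot_product_set E F| * k))%N.
Proof.
move=> horth hk E0 F0.
have D0 : (0 < #|dot_product_set E F|)%N.
  case/card_gt0P: E0 => v vE; case/card_gt0P: F0 => f fF.
  by apply/card_gt0P; exists (dot v f); apply: imset2_f.
have := card_pairs_le hk; have := card_separated D0.
set d := (_ ^ 3)%N; set m := (_ * k)%N; set e1 := #|separated E F| => e1d hp.
have [le|lt] := leqP #|E| (4 * e1); first by left; lia.
right; rewrite -(leq_pmul2l E0).
(* Orthogonal pairs take at most half of |E||F| and separated vectors at most a quarter, which
   leaves a quarter for |E||D|k. *)
have : (4 * e1 * #|F| <= #|E| * #|F|)%N by rewrite leq_mul2r (ltnW lt) orbT.
nia.
Qed.

Theorem theorem1p7 (R : realType) :
  exists C : R, 0 < C /\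
  forall (K : finFieldType) (k : nat) (alpha : R) (E F : {set 'rV[K]_3}),
    let q : R := #|K|%:R in
    let D : {set K} := dot_product_set E F in
    #|orthogonal_pairs E F|%:R <= #|E|%:R * #|F|%:R / 2 :> R ->
    common_collinear_bound E F k ->
    2 * k%:R * q `^ alpha < #|F|%:R ->
    ~ contained_in_plane E ->
    (q `^ (3 * alpha) <= #|E|%:R ->
       Num.max k%:R (q `^ alpha) <= C * #|D|%:R) /\
    (#|E|%:R <= q `^ (3 * alpha) ->
       Num.max k%:R (#|E|%:R / q `^ (2 * alpha)) <= C * #|D|%:R).
Proof.
(* The constant 2 fits both cases of [dichotomy]: 4|D|^3 <= (2|D|)^3, and 2kQ < |F| <= 4|D|k gives Q
   < 2|D|, where Q is q^alpha. *)
exists 2; split=> // K k alpha E F q D horth hk hF nE.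
have q0 : 0 < q by rewrite ltr0n; apply/card_gt0P; exists 0.
have powq (n : nat) : q `^ (n%:R * alpha) = (q `^ alpha) ^+ n.
  by rewrite mulrC powRrM powR_mulrn // powR_ge0.
rewrite !powq; have Q0 : 0 < q `^ alpha by apply: powR_gt0.
move: (q `^ alpha) Q0 hF => Q Q0 hF.
have [k0 hkle _] := hk.
have F0 : (0 < #|F|)%N.
  by rewrite -(ltr0n R); apply: le_lt_trans hF; rewrite !mulr_ge0 // ltW.
have E0 : (0 < #|E|)%N.
  (* An empty E would lie in any plane. *)
  rewrite card_gt0; apply/eqP => E0; apply: nE; exists (const_mx 1), 0.
  rewrite E0 sub0set; split=> //.
  by apply/eqP => /matrixP/(_ 0 0); rewrite !mxE => /eqP; rewrite oner_eq0.
have D0 : (0 < #|D|)%N.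
  case/card_gt0P: E0 => v vE; case/card_gt0P: F0 => f fF.
  by apply/card_gt0P; exists (dot v f); apply: imset2_f.
have kD : k%:R <= 2 * #|D|%:R :> R.
  by rewrite -natrM ler_nat (leq_trans (bound_le_card_dot hk nE D0)) // leq_pmull.
have horthN : (2 * #|orthogonal_pairs E F| <= #|E| * #|F|)%N.
  by rewrite -(ler_nat R) !natrM; lra.
have main : #|E|%:R <= (2 * #|D|%:R) ^+ 3 :> R \/ Q <= 2 * #|D|%:R :> R.
  have [h|h] := dichotomy horthN hkle E0 F0; [left|right].
    rewrite -natrM -natrX ler_nat (leq_trans h) // expnMn leq_mul2r.
    by rewrite orbT.
  have k0R : 0 < k%:R :> R by rewrite ltr0n.
  rewrite -(ler_pM2l k0R).
  by move: h; rewrite -(ler_nat R) !natrM => h; lra.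
set d2 := 2 * #|D|%:R in kD main *.
have d20 : 0 <= d2 by rewrite mulr_ge0.
rewrite !ge_max kD /=; split=> hE.
  case: main => [|//] /(le_trans hE).
  by rewrite ler_pXn2r // nnegrE ltW.
rewrite ler_pdivrMr ?exprn_gt0 //.
(* If Q <= d2, then |E| <= Q^3 <= d2 Q^2; if d2 < Q, the cubic alternative gives |E| <= d2^3 <= d2
   Q^2. *)
have [le|lt] := leP Q d2.
  by rewrite (le_trans hE) // exprS ler_wpM2r // exprn_ge0 // ltW.
case: main => [main|]; last by rewrite leNgt lt.
by rewrite (le_trans main) // exprS ler_wpM2l // lerXn2r ?nnegrE // ltW.
Qed.
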